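(* Let $k \geq 1$ be an integer and $n \in \mathbb{Z}$, and put $\epsilon := (-1)^n$. Then, as $x \to 1^-$ ($x$ real, $x<1$), $$ f_{k,n}(-x) = \frac{\pi^{k/2}\sqrt{2}}{\sqrt{k+1}}\,\frac{\cos\big((k+\epsilon)\pi/4\big)}{(1-x)^{k/2}} + O\left(\frac{1}{(1-x)^{(k-1)/2}}\right). $$
   Context: For $k \ge 1$ and $m=(m_1,\dots,m_k)\in\mathbb{Z}^k$ put $S(m) := \sum_{1\le i\le k} m_i$ and $Q(m) := \sum_{1\le i\le j\le k} m_i m_j$ (a positive definite quadratic form taking integer values on $\mathbb{Z}^k$). For $n\in\mathbb{Z}$ and $x \in \mathbb{C}$ with $0<|x|<1$, define $$f_{k,n}(x) := \sum_{m\in\mathbb{Z}^k} x^{Q(m)-nS(m)},$$ an absolutely convergent series. *)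

(* Defs.v *)
From mathcomp Require Import all_boot all_order all_algebra.
From mathcomp Require Import all_classical all_reals all_analysis.
From mathcomp Require Import complex.
From mathcomp Require summability.
Import Order.TTheory GRing.Theory Num.Theory.
Import numFieldNormedType.Exports.

Set Implicit Arguments.
Unset Strict Implicit.
Unset Printing Implicit Defensive.

Local Open Scope ring_scope.
Local Open Scope complex_scope.

Definition linear_form (k : nat) (m : {ffun 'I_k -> int}) : int :=
  \sum_(i < k) m i.

Definition quadratic_form (k : nat) (m : {ffun 'I_k -> int}) : int :=
  \sum_(i < k) \sum_(j < k | (i <= j)%N) m i * m j.

(* summability.sum is the unordered sum: the limit of the partial sums along
   the finite subsets of the index type, directed by inclusion.  The alias ^o
   carries the normed topology of the modulus on R[i]; its elements are those
   of R[i]. *)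
Definition fkn (R : realType) (k : nat) (n : int) (x : R[i]) : (R[i])^o :=
  summability.sum (fun m : {ffun 'I_k -> int} =>
    (x ^ (quadratic_form m - n * linear_form m) : (R[i])^o)).

(* Main.v *)
Require Import Defs.
From mathcomp Require Import all_boot all_order all_algebra.
From mathcomp Require Import all_classical all_reals all_analysis.
From mathcomp Require Import complex.
From mathcomp Require Import measurable_realfun finmap ring lra zify.
From mathcomp Require summability.
Import Order.TTheory GRing.Theory Num.Theory.
Import numFieldNormedType.Exports.

(* Since 2 Q(m) = sum m_i^2 + S(m)^2, writing x = exp(-2 h^2) gives
   x^(Q(m) - n S(m)) = exp(h^2 n^2) exp(- h^2 (sum m_i^2 + (S(m) - n)^2)), while
   the sign (-1)^(Q(m) - n S(m)) depends only on the number of odd entries of m.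
   For a weight w depending only on that number, the sum of
   w exp(- h^2 (sum m_i^2 + lam (S(m) + s)^2)) is evaluated up to a relative
   error O(h), one coordinate at a time: completing the square leaves a
   one-dimensional Gaussian sum over the even or the odd integers, which equals
   half the Gaussian integral up to O(1) whatever its centre, and the remaining
   sum has the same shape with lam / (1 + lam) in place of lam and with w j
   replaced by (w j + w j.+1) / 2.  Starting from
   w j = sqrt 2 cos(pi / 4 + (-1)^n j pi / 2), each averaging produces a
   factor cos(pi / 4) and a phase (-1)^n pi / 4. *)

Local Open Scope classical_set_scope.
Local Open Scope ring_scope.
Local Open Scope complex_scope.

Set Implicit Arguments.
Unset Strict Implicit.
Unset Printing Implicit Defensive.

(** * Sums of nonnegative families *)

Section HasSum.
Context {R : realType}.

(* Only meaningful for nonnegative families: [esum] is a supremum of finite sums. *)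
Definition has_sum (T : choiceType) (f : T -> R) (s : R) : Prop :=
  (\esum_(i in [set: T]) (f i)%:E)%R = s%:E.

Lemma has_sum_le_ex (T : choiceType) (f g : T -> R) (s : R) :
  (forall i, 0 <= f i <= g i) -> has_sum g s ->
  exists t, has_sum f t.
Proof.
move=> fg gs; have f0 i : [set: T] i -> (0 <= (f i)%:E)%E.
  by rewrite lee_fin; case/andP: (fg i).
exists (fine (\esum_(i in [set: T]) (f i)%:E)); rewrite /has_sum fineK//.
rewrite ge0_fin_numE; last exact: esum_ge0.
apply: le_lt_trans (ltry s); rewrite -gs; apply: le_esum => i _.
by rewrite lee_fin; case/andP: (fg i).
Qed.

Lemma has_sum_le (T : choiceType) (f g : T -> R) (s t : R) :
  (forall i, f i <= g i) -> has_sum f s -> has_sum g t -> s <= t.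
Proof.
by move=> fg fs gt; rewrite -lee_fin -fs -gt; apply: le_esum => i _; rewrite lee_fin.
Qed.

Lemma has_sum_ge0 (T : choiceType) (f : T -> R) (s : R) :
  (forall i, 0 <= f i) -> has_sum f s -> 0 <= s.
Proof.
by move=> f0 fs; rewrite -lee_fin -fs; apply: esum_ge0 => i _; rewrite lee_fin.
Qed.

Lemma eq_has_sum (T : choiceType) (f g : T -> R) (s : R) :
  f =1 g -> has_sum f s -> has_sum g s.
Proof. by move=> fg; rewrite /has_sum => <-; apply: eq_esum => i _; rewrite fg. Qed.

Lemma has_sumD (T : choiceType) (f g : T -> R) (s t : R) :
  (forall i, 0 <= f i) -> (forall i, 0 <= g i) ->
  has_sum f s -> has_sum g t -> has_sum (fun i => f i + g i) (s + t).
Proof.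
move=> f0 g0 fs gt; rewrite /has_sum EFinD -fs -gt -esumD//.
- by move=> i _; rewrite lee_fin.
- by move=> i _; rewrite lee_fin.
Qed.

Lemma has_sumZ (T : choiceType) (c : R) (f : T -> R) (s : R) :
  0 <= c -> has_sum f s -> has_sum (fun i => c * f i) (c * s).
Proof.
move=> c0 fs; rewrite /has_sum EFinM -fs /esum -ereal_supZl//; last first.
  by apply/set0P; exists (\sum_(x \in (set0 : set T)) (f x)%:E)%E; exists set0.
congr ereal_sup; apply/seteqP; split=> [_ [X [finX XT] <-]|_ [_ [X [finX XT] <-] <-]].
  exists (\sum_(x \in X) (f x)%:E)%E; first by exists X.
  by rewrite !fsbig_finite//= !sumEFin -EFinM mulr_sumr.
exists X => //.
by rewrite !fsbig_finite//= !sumEFin -EFinM mulr_sumr.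
Qed.

Lemma has_sum_bij (T U : choiceType) (e : T -> U) (f : U -> R) (s : R) :
  bijective e -> has_sum (f \o e) s -> has_sum f s.
Proof.
move=> [e' ee' e'e] fs; rewrite /has_sum -fs.
rewrite (reindex_esum [set: T] [set: U] e)//; split => //.
- by move=> i j _ _ /(congr1 e'); rewrite !ee'.
- by move=> j _; exists (e' j).
Qed.

Lemma has_sum_split (T U V : choiceType) (e1 : T -> V) (e2 : U -> V)
    (f : V -> R) (s t : R) :
  injective e1 -> injective e2 -> (forall i j, e1 i <> e2 j) ->
  (forall x, (exists i, e1 i = x) \/ (exists j, e2 j = x)) ->
  (forall x, 0 <= f x) ->
  has_sum (f \o e1) s -> has_sum (f \o e2) t -> has_sum f (s + t).
Proof.
move=> i1 i2 dis cov f0 fs ft; rewrite /has_sum EFinD -fs -ft.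
rewrite (esumID (range e1)); last by move=> i _; rewrite lee_fin.
rewrite !setTI; congr (_ + _)%E.
  by rewrite esum_image//; move=> ? ? _ _; exact: i1.
have -> : ~` range e1 = range e2.
  apply/seteqP; split=> [x /= nx|_ [j _ <-] [i _]]; last exact: dis.
  by case: (cov x) => -[i <-] in nx *; [case: nx; exists i|exists i].
by rewrite esum_image//; move=> ? ? _ _; exact: i2.
Qed.

(** Tonelli's theorem for nonnegative families. It lets a lattice sum be evaluated one coordinate at
    a time. *)
Lemma has_sum_pair (T U : choiceType) (f : T * U -> R) (g : T -> R) (s : R) :
  (forall x, 0 <= f x) ->
  (forall i, has_sum (fun j => f (i, j)) (g i)) -> has_sum g s -> has_sum f s.
Proof.
move=> f0 fg gs; rewrite /has_sum -gs.
transitivity (\esum_(i in [set: T]) \esum_(j in [set: U]) (f (i, j))%:E); last first.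
  by apply: eq_esum => i _; exact: fg.
rewrite (esum_esum (J := fun=> [set: U])); last by move=> i j _ _; rewrite lee_fin.
rewrite (_ : setT `*`` _ = setT); last by apply/seteqP; split.
by apply: eq_esum => -[].
Qed.

Lemma has_sum1 (T : choiceType) (a : T) (f : T -> R) :
  (forall x, x = a) -> 0 <= f a -> has_sum f (f a).
Proof.
move=> ha f0; rewrite /has_sum.
rewrite (_ : setT = [set a]) ?esum_set1//.
by apply/seteqP; split => x // _; exact: ha.
Qed.

Lemma has_sum_uniq (T : choiceType) (f : T -> R) (s t : R) :
  has_sum f s -> has_sum f t -> s = t.
Proof. by rewrite /has_sum => -> []. Qed.

Lemma has_sum_recl (f : nat -> R) (s : R) : (forall n, 0 <= f n) ->
  has_sum (fun n => f n.+1) s -> has_sum f (f 0%N + s).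
Proof.
move=> f0 fs; apply: (@has_sum_split unit nat nat (fun=> 0%N) succn) => //.
- by case; case.
- exact: succn_inj.
- by case=> [|n]; [left; exists tt|right; exists n].
- by apply: (@has_sum1 _ tt (f \o (fun=> 0%N))) => [[]|/=].
Qed.

(** Some finite sum comes within [e] of the supremum, and enlarging the finite set can only increase
    a sum of nonnegative terms. This is the form needed for convergence along finite subsets. *)
Lemma has_sum_fset (T : choiceType) (f : T -> R) (s e : R) :
  (forall i, 0 <= f i) -> has_sum f s -> 0 < e ->
  exists A : {fset T}, forall B : {fset T}, (A `<=` B)%fset ->
    s - e <= \sum_(i <- B) f i <= s.
Proof.
move=> f0 fs e0.
have sub (B : {fset T}) : \sum_(i <- B) f i <= s.
  rewrite -lee_fin -sumEFin -fs; apply: esum_ge; exists [set` B] => //.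
  by rewrite fsbig_finite//= set_fsetK.
have : ((s - e)%:E < \esum_(i in [set: T]) (f i)%:E)%E.
  by rewrite fs lte_fin ltrBlDr ltrDl.
move=> /ereal_sup_gt [_ [X [finX _] <-]]; rewrite fsbig_finite//= sumEFin lte_fin => lt.
exists (fset_set X) => B XB; rewrite sub andbT (le_trans (ltW lt))//.
rewrite [leRHS](big_fsetID _ (mem (fset_set X))) /=.
rewrite (_ : [fset x in B | x \in fset_set X]%fset = fset_set X); last first.
  by apply/fsetP => x; rewrite !inE /=; apply: andb_idl; exact: (fsubsetP XB).
by rewrite lerDl sumr_ge0.
Qed.

End HasSum.

(** * One-dimensional Gaussian sums *)

Section Gauss.
Context {R : realType}.
Implicit Types (h c d : R).

Lemma gauss_fun_even (x : R) : gauss_fun (- x) = gauss_fun x.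
Proof. by rewrite /gauss_fun sqrrN. Qed.

Lemma gauss_fun_anti (x y : R) : 0 <= x -> x <= y -> gauss_fun y <= gauss_fun x.
Proof.
move=> x0 xy; rewrite ler_expR lerN2.
by rewrite ler_sqr ?nnegrE// (le_trans x0).
Qed.

(** The Gaussian decreases on the nonnegative half-line, so on each slice it lies between its values
    at the two endpoints. *)
Lemma gauss_slice (h : R) (n : nat) : 0 < h ->
  let I := (\int[lebesgue_measure]_(x in `[(h * n%:R)%R, (h * n.+1%:R)%R[)
              (gauss_fun x)%:E)%E in
  ((h * gauss_fun (h * n.+1%:R))%:E <= I <= (h * gauss_fun (h * n%:R))%:E)%E.
Proof.
move=> h0 /=.
have hn m : 0 <= h * m%:R by rewrite mulr_ge0// ltW.
have step : h * n.+1%:R - h * n%:R = h by rewrite -natr1; ring.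
have lt : h * n%:R < h * n.+1%:R by rewrite -subr_gt0 step.
have cst r : (\int[lebesgue_measure]_(x in `[(h * n%:R)%R, (h * n.+1%:R)%R[)
              r%:E)%E = (h * r)%:E.
  rewrite integral_cst//= lebesgue_measure_itv/= lte_fin lt -EFinB -EFinM.
  by rewrite step mulrC.
have mg : measurable_fun `[h * n%:R, h * n.+1%:R[%classic
    (fun x : R => (gauss_fun x)%:E : \bar R).
  by apply/measurable_EFinP/measurable_funTS; exact: measurable_gauss_fun.
rewrite -!cst; apply/andP; split; apply: ge0_le_integral => //=;
  try by move=> x _; rewrite lee_fin gauss_fun_ge0.
- move=> x; rewrite in_itv/= => /andP[nx xn]; rewrite lee_fin gauss_fun_anti//.
  + exact: le_trans nx.
  + exact: ltW.
- by move=> x; rewrite in_itv/= => /andP[nx xn]; rewrite lee_fin gauss_fun_anti.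
Qed.

Lemma gauss_slices (h : R) : 0 < h ->
  (\sum_(0 <= n <oo) \int[lebesgue_measure]_(x in `[(h * n%:R)%R, (h * n.+1%:R)%R[)
              (gauss_fun x)%:E)%E = (Num.sqrt pi / 2)%:E.
Proof.
move=> h0; rewrite -integral0y_gauss.
have -> : `[0, +oo[%classic = \bigcup_n `[(h * n%:R)%R, (h * n.+1%:R)%R[%classic.
  apply/seteqP; split => [x|x [n _]]; rewrite /= !in_itv/= ?andbT.
    move=> x0; exists (Num.truncn (x / h)) => //=; rewrite in_itv/=.
    have /truncn_itv := divr_ge0 x0 (ltW h0).
    by rewrite ler_pdivlMr// ltr_pdivrMr// mulrC (mulrC _ h).
  by move=> /andP[+ _]; apply: le_trans; rewrite mulr_ge0// ltW.
rewrite ge0_integral_bigcup//=.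
- apply/measurable_EFinP/measurable_funTS; exact: measurable_gauss_fun.
- by move=> x _; rewrite lee_fin gauss_fun_ge0.
apply/trivIsetP => i j _ _; wlog ij : i j / (i < j)%N => [H|_].
  case: (ltngtP i j) => // ij _; first by apply: H => //; rewrite ltn_eqF.
  by rewrite setIC; apply: H => //; rewrite ltn_eqF.
rewrite -subset0 => x [] /=; rewrite !in_itv/= => /andP[_ xi] /andP[jx _].
have : h * j%:R < h * i.+1%:R by exact: le_lt_trans xi.
by rewrite ltr_pM2l// ltr_nat ltnS leqNgt ij.
Qed.

Lemma has_sum_gauss_recl (h s : R) :
  has_sum (fun n : nat => gauss_fun (h * n.+1%:R)) s ->
  has_sum (fun n : nat => gauss_fun (h * n%:R)) (1 + s).
Proof.
move=> ss; have := @has_sum_recl _ (fun n => gauss_fun (h * n%:R)) s _ ss.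
rewrite (_ : gauss_fun (h * 0%:R) = 1); last first.
  by rewrite mulr0 /gauss_fun expr0n oppr0 expR0.
by apply=> n; exact: gauss_fun_ge0.
Qed.

(** Integral comparison: summing the slice bounds traps half the Gaussian integral between the right
    and the left Riemann sums, which differ by the term [h] at 0. *)
Lemma has_sum_gauss_pos (h : R) : 0 < h ->
  exists2 s, has_sum (fun n : nat => gauss_fun (h * n.+1%:R)) s &
    h * s <= Num.sqrt pi / 2 <= h * (1 + s).
Proof.
move=> h0.
have g0 n : (0 <= (gauss_fun (h * n%:R))%:E)%E by rewrite lee_fin gauss_fun_ge0.
set S := (\sum_(0 <= n <oo) (gauss_fun (h * n.+1%:R))%:E)%E.
have S0 : (0 <= S)%E by apply: nneseries_ge0.
have lo : (h%:E * S <= (Num.sqrt pi / 2)%:E)%E.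
  rewrite -(gauss_slices h0) -nneseriesZl//; apply: lee_nneseries => n _.
    by rewrite mule_ge0// lee_fin ltW.
  by have /andP[] := gauss_slice n h0.
(* As [h] is positive, the bound [lo] excludes an infinite sum. *)
have Sfin : S \is a fin_num.
  rewrite ge0_fin_numE//; move: lo; case: S {S0} => [r _| |_]//=.
    by rewrite ltry.
  by rewrite gt0_muley ?lte_fin// leye_eq.
have hS : has_sum (fun n : nat => gauss_fun (h * n.+1%:R)) (fine S).
  by rewrite /has_sum fineK// /S nneseries_esumT.
exists (fine S) => //.
apply/andP; split; rewrite -lee_fin; first by rewrite EFinM fineK.
have := has_sum_gauss_recl hS.
rewrite -(gauss_slices h0) EFinM /has_sum => <-.
rewrite -nneseries_esumT// -nneseriesZl//; apply: lee_nneseries => n _.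
  by move=> _; apply: integral_ge0 => x _; rewrite lee_fin gauss_fun_ge0.
by have /andP[] := gauss_slice n h0.
Qed.

(** By monotonicity the shifted sum lies between the sums over [n >= 2] and over [n >= 0]. These
    differ by two terms, each at most 1. *)
Lemma has_sum_gauss_half (h d : R) : 0 < h -> 0 <= d <= 2 ->
  exists2 s, has_sum (fun n : nat => gauss_fun (h * (n%:R + d))) s &
    `|s - Num.sqrt pi / 2 / h| <= 2.
Proof.
move=> h0 /andP[d0 d2].
have [s ss /andP[lo hi]] := has_sum_gauss_pos h0.
have g0 x : 0 <= @gauss_fun R x by exact: gauss_fun_ge0.
have T0 := has_sum_gauss_recl ss.
have [t2 T2] : exists t, has_sum (fun n : nat => gauss_fun (h * n.+2%:R)) t.
  apply: has_sum_le_ex ss => n; rewrite g0 gauss_fun_anti//.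
    by rewrite mulr_ge0// ltW.
  by rewrite ler_pM2l// ler_nat.
have et : s = gauss_fun (h * 1) + t2.
  apply: has_sum_uniq ss _.
  by apply: (@has_sum_recl _ (fun n => gauss_fun (h * n.+1%:R))).
have [t T] : exists t, has_sum (fun n : nat => gauss_fun (h * (n%:R + d))) t.
  apply: has_sum_le_ex T0 => n; rewrite g0 gauss_fun_anti//.
    by rewrite mulr_ge0// ltW.
  by rewrite ler_pM2l// lerDl.
exists t => //.
have t_le : t <= 1 + s.
  apply: has_sum_le T T0 => n; rewrite gauss_fun_anti//.
    by rewrite mulr_ge0// ltW.
  by rewrite ler_pM2l// lerDl.
have t_ge : t2 <= t.
  apply: has_sum_le T2 T => n; rewrite gauss_fun_anti//.
    by rewrite mulr_ge0 ?addr_ge0// ltW.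
  by rewrite ler_pM2l// -addn2 natrD lerD2l.
have g1 := @gauss_fun_le1 R (h * 1).
move: lo hi; rewrite -(ler_pdivlMl _ _ h0) -(ler_pdivrMl _ _ h0) mulrC => lo hi.
by rewrite ler_norml; lra.
Qed.

Lemma has_sum_gauss_int (h c : R) : 0 < h ->
  exists2 s, has_sum (fun m : int => gauss_fun (h * (m%:~R + c))) s &
    `|s - Num.sqrt pi / h| <= 4.
Proof.
move=> h0.
set f := Num.floor c; set d := c - f%:~R.
have /andP[d0 d1] : 0 <= d < 1.
  by have := real_floor_itv (num_real c); rewrite intrD /d => /andP[? ?]; lra.
have [s1 S1 b1] := @has_sum_gauss_half h d h0 ltac:(lra).
have [s2 S2 b2] := @has_sum_gauss_half h (1 - d) h0 ltac:(lra).
exists (s1 + s2); last first.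
  move: b1 b2; rewrite (_ : Num.sqrt pi / h = Num.sqrt pi / 2 / h + Num.sqrt pi / 2 / h); last first.
    by field; rewrite gt_eqF.
  by rewrite !ler_norml; lra.
(* After translation by the floor of [c], the centre is the fractional part [d]. The integers
   [m >= 0] give a half sum with offset [d], and the negative ones, by evenness, one with offset
   [1 - d]. *)
apply: (@has_sum_bij _ _ _ (fun m : int => m - f)).
  by exists (fun m => m + f) => m; rewrite ?addrK ?subrK.
apply: (has_sum_split (e1 := Posz) (e2 := Negz)) => //.
- by move=> i j [].
- by move=> i j [].
- by case=> n; [left; exists n|right; exists n].
- by move=> m; exact: gauss_fun_ge0.
- apply: eq_has_sum S1 => n /=; congr gauss_fun; rewrite intrB /d; ring.
- apply: eq_has_sum S2 => n /=; rewrite -gauss_fun_even; congr gauss_fun.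
  rewrite intrB /d NegzE intrN -[(n.+1%:Z)%:~R]/(n.+1%:R) -natr1; ring.
Qed.

(** The even and the odd integers each give a full Gaussian sum of step [2 * h], hence half of
    [Num.sqrt pi / h] up to 4. The weights, at most [B], turn the two errors into [8 * B]. *)
Lemma has_sum_gauss_parity (h c a b B : R) : 0 < h -> 0 <= a <= B -> 0 <= b <= B ->
  exists2 s, has_sum (fun m : int =>
      (if odd `|m|%N then b else a) * gauss_fun (h * (m%:~R + c))) s &
    `|s - (a + b) / 2 * (Num.sqrt pi / h)| <= 8 * B.
Proof.
move=> h0 /andP[a0 aB] /andP[b0 bB].
have h20 : 0 < 2 * h by rewrite mulr_gt0.
have [s1 S1 b1] := @has_sum_gauss_int (2 * h) (c / 2) h20.
have [s2 S2 b2] := @has_sum_gauss_int (2 * h) ((1 + c) / 2) h20.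
exists (a * s1 + b * s2); last first.
  move: b1 b2; rewrite (_ : Num.sqrt pi / (2 * h) = Num.sqrt pi / h / 2); last first.
    by field; rewrite gt_eqF.
  move: (Num.sqrt pi / h) => r b1 b2.
  rewrite (_ : _ - _ = a * (s1 - r / 2) + b * (s2 - r / 2)); last by field.
  rewrite (le_trans (ler_normD _ _))// !normrM (ger0_norm a0) (ger0_norm b0).
  rewrite (_ : 8 * B = B * 4 + B * 4); last by ring.
  by rewrite lerD// ler_pM.
apply: (has_sum_split (e1 := fun u : int => 2 * u) (e2 := fun u : int => 2 * u + 1)).
- by move=> i j /=; lia.
- by move=> i j /=; lia.
- by move=> i j /=; lia.
- move=> x; case: (boolP (odd `|x|%N)) => xo.
    by right; exists (x %/ 2)%Z; lia.
  by left; exists (x %/ 2)%Z; lia.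
- by move=> m; rewrite mulr_ge0 ?gauss_fun_ge0//; case: ifP.
- apply: eq_has_sum (has_sumZ a0 S1) => u /=.
  rewrite (_ : odd _ = false); last by lia.
  by congr (_ * gauss_fun _); rewrite intrM; field.
- apply: eq_has_sum (has_sumZ b0 S2) => u /=.
  rewrite (_ : odd _ = true); last by lia.
  by congr (_ * gauss_fun _); rewrite intrD intrM; field.
Qed.

End Gauss.

(** * Gaussian sums over lattices *)

Section ConsFfun.
Context (k : nat).
Implicit Types (m : {ffun 'I_k -> int}) (x : int).

Definition odd_count k (m : {ffun 'I_k -> int}) : nat := (\sum_(i < k) odd `|m i|)%N.

Definition square_sum k (m : {ffun 'I_k -> int}) : int := \sum_(i < k) m i ^+ 2.

(** The new coordinate goes to index 0. It is the second component of the pair because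
    [has_sum_pair] sums the second component first. *)
Definition consf (p : {ffun 'I_k -> int} * int) : {ffun 'I_k.+1 -> int} :=
  [ffun i => oapp p.1 p.2 (unlift ord0 i)].

Lemma consf0 m x : consf (m, x) ord0 = x.
Proof. by rewrite ffunE unlift_none. Qed.

Lemma consf_lift m x i : consf (m, x) (lift ord0 i) = m i.
Proof. by rewrite ffunE liftK. Qed.

Lemma consf_bij : bijective consf.
Proof.
exists (fun m : {ffun 'I_k.+1 -> int} =>
  ([ffun i : 'I_k => m (lift ord0 i)], m ord0)) => [[m x]|m].
  by rewrite consf0; congr pair; apply/ffunP => i; rewrite ffunE consf_lift.
apply/ffunP => i; case: (unliftP ord0 i) => [j|] ->.
  by rewrite consf_lift ffunE.
by rewrite consf0.
Qed.

Lemma odd_count_consf m x : odd_count (consf (m, x)) = (odd `|x| + odd_count m)%N.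
Proof.
rewrite /odd_count big_ord_recl consf0; congr addn.
by apply: eq_bigr => i _; rewrite consf_lift.
Qed.

Lemma square_sum_consf m x : square_sum (consf (m, x)) = x ^+ 2 + square_sum m.
Proof.
rewrite /square_sum big_ord_recl consf0; congr +%R.
by apply: eq_bigr => i _; rewrite consf_lift.
Qed.

Lemma linear_form_consf m x : linear_form (consf (m, x)) = x + linear_form m.
Proof.
rewrite /linear_form big_ord_recl consf0; congr +%R.
by apply: eq_bigr => i _; rewrite consf_lift.
Qed.

Lemma quadratic_form_consf m x :
  quadratic_form (consf (m, x)) = x ^+ 2 + x * linear_form m + quadratic_form m.
Proof.
rewrite /quadratic_form big_ord_recl; congr +%R.
  rewrite big_ord_recl consf0 -expr2; congr +%R.
  by rewrite /linear_form mulr_sumr; apply: eq_bigr => i _; rewrite consf_lift.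
apply: eq_bigr => i _; rewrite big_mkcond big_ord_recl /= add0r.
rewrite [RHS]big_mkcond; apply: eq_bigr => j _.
by rewrite !consf_lift.
Qed.

End ConsFfun.

Lemma quadratic_formE k (m : {ffun 'I_k -> int}) :
  2 * quadratic_form m = square_sum m + linear_form m ^+ 2.
Proof.
elim: k m => [|k IH] m.
  by rewrite /quadratic_form /square_sum /linear_form !big_ord0; ring.
have [e _ eK] := consf_bij k; rewrite -(eK m); case: (e m) => {}m x.
rewrite quadratic_form_consf square_sum_consf linear_form_consf.
by rewrite mulrDr IH; ring.
Qed.

(** * Weighted theta sums, by induction on the dimension *)

Section ThetaSum.
Context {R : realType}.
Implicit Types (w : nat -> R) (h lam s : R).

Definition theta_term k (lam s h : R) (m : {ffun 'I_k -> int}) : R :=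
  expR (- (h ^+ 2 * ((square_sum m)%:~R + lam * ((linear_form m)%:~R + s) ^+ 2))).

(** This is the mean of [w j] under the binomial law ['C(k, j) / 2 ^ k]: the parities of the [k]
    entries behave like independent fair coins. *)
Fixpoint binomial_mean (k : nat) (w : nat -> R) : R :=
  if k is k'.+1 then binomial_mean k' (fun j => (w j + w j.+1) / 2) else w 0%N.

Lemma binomial_mean_cst k (c : R) : binomial_mean k (fun=> c) = c.
Proof.
elim: k => //= k IH; rewrite -[RHS]IH; congr binomial_mean.
by apply/funext => j; field.
Qed.

(* Completing the square in the new coordinate. *)
Lemma theta_term_consf k lam s h (m : {ffun 'I_k -> int}) x : 0 <= lam ->
  theta_term lam s h (consf (m, x)) =
  theta_term (lam / (1 + lam)) s h m *
  gauss_fun (h * Num.sqrt (1 + lam) *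
             (x%:~R + lam / (1 + lam) * ((linear_form m)%:~R + s))).
Proof.
move=> l0; rewrite /theta_term /gauss_fun -expRD; congr expR.
rewrite square_sum_consf linear_form_consf !exprMn sqr_sqrtr ?addr_ge0//.
by rewrite !intrD rmorphXn/=; field; rewrite gt_eqF// ltr_wpDr.
Qed.

(* The shift [s] is the same in every dimension and only matters at [k = 0];
   the constant does not depend on [lam], which changes along the induction. *)
Lemma theta_sum k s : exists2 C : R, 0 <= C &
  forall (lam h B : R) (w : nat -> R), 0 <= lam <= 1 -> 0 < h <= 1 ->
  (forall j, 0 <= w j <= B) ->
  exists2 S, has_sum (fun m : {ffun 'I_k -> int} =>
                        w (odd_count m) * theta_term lam s h m) S &
    `|S * h ^+ k - binomial_mean k w * Num.sqrt pi ^+ k / Num.sqrt (1 + k%:R * lam)|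
      <= C * B * h.
Proof.
elim: k => [|k [C C0 IH]].
  (* In dimension 0 there is one term, and the error is [w 0] times [1 - expR (- t)] with
     [t = h ^+ 2 * (lam * s ^+ 2)], which is at most [s ^+ 2 * h]. *)
  exists (s ^+ 2); first exact: sqr_ge0.
  move=> lam h B w /andP[l0 l1] /andP[h0 h1] wB.
  have /andP[w0 w0B] := wB 0%N.
  have B0 : 0 <= B by exact: le_trans w0B.
  have wj0 j : 0 <= w j by have /andP[] := wB j.
  have all0 (m : {ffun 'I_0 -> int}) : m = [ffun=> 0].
    by apply/ffunP => -[].
  eexists.
    apply: (has_sum1 all0).
    by rewrite mulr_ge0 ?expR_ge0.
  rewrite /theta_term /odd_count /square_sum /linear_form !big_ord0 !add0r.
  rewrite !expr0 !mulr1 mul0r addr0 sqrtr1 divr1 /=.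
  rewrite -[X in _ - X]mulr1 -mulrBr normrM ger0_norm//.
  rewrite (_ : s ^+ 2 * B * h = B * (s ^+ 2 * h)); last by ring.
  apply: ler_pM => //.
  set t := h ^+ 2 * _.
  have t0 : 0 <= t by rewrite mulr_ge0 ?sqr_ge0// mulr_ge0 ?sqr_ge0.
  have th : t <= s ^+ 2 * h.
    rewrite /t mulrCA (mulrC (s ^+ 2)) mulrA ler_wpM2r ?sqr_ge0//.
    rewrite expr2 mulrA ler_piMl ?(ltW h0)// mulr_ile1// ltW//.
  have := expR_ge1Dx (- t); have : expR (- t) <= 1 by rewrite expR_le1; lra.
  by rewrite ler_norml; lra.
set q := Num.sqrt pi in IH *.
have q0 : 0 <= q by exact: sqrtr_ge0.
(* The first summand pays for the errors of the inner one-dimensional sums, the second for the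
   induction hypothesis scaled by [q / r <= q]. *)
exists (8 * (q ^+ k + C) + q * C).
  by rewrite !(addr_ge0, mulr_ge0, exprn_ge0).
move=> lam h B w l01 h01 wB.
have /andP[l0 l1] := l01; have /andP[h0 h1] := h01.
have w0 j : 0 <= w j by have /andP[] := wB j.
have B0 : 0 <= B by have /andP[_] := wB 0%N; exact: le_trans.
have l10 : 0 < 1 + lam by rewrite ltr_wpDr.
set lam' := lam / (1 + lam).
have l'01 : 0 <= lam' <= 1.
  by rewrite divr_ge0 ?(ltW l10)//= ler_pdivrMr// mul1r lerDr.
have l'0 : 0 <= lam' by have /andP[] := l'01.
set r := Num.sqrt (1 + lam).
have r1 : 1 <= r by rewrite -[leLHS]sqrtr1 ler_sqrt ?lerDl// ltW.
have r0 : 0 < r by exact: lt_le_trans r1.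
set v := fun j => (w j + w j.+1) / 2.
have vB j : 0 <= v j <= B.
  by have := wB j; have := wB j.+1; rewrite /v => /andP[? ?] /andP[? ?]; lra.
have [U Us Ub] := IH lam' h B v l'01 h01 vB.
(* The unweighted sum [V] measures the total of the inner errors, each at most [8 * B] times a theta
   term. *)
have [V Vs Vb] := IH lam' h 1 (fun=> 1) l'01 h01 (fun j => ltac:(by rewrite ler01 lexx)).
have hr0 : 0 < h * r by rewrite mulr_gt0.
have /choice [sg sgP] : forall m : {ffun 'I_k -> int}, exists t,
    has_sum (fun x : int => (if odd `|x|%N then w (odd_count m).+1 else w (odd_count m)) *
       gauss_fun (h * r * (x%:~R + lam / (1 + lam) * ((linear_form m)%:~R + s)))) t /\
    `|t - v (odd_count m) * (q / (h * r))| <= 8 * B.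
  move=> m.
  have [t t1 t2] := has_sum_gauss_parity (lam / (1 + lam) * ((linear_form m)%:~R + s))
    hr0 (wB (odd_count m)) (wB (odd_count m).+1).
  by exists t.
set c := q / (h * r); have c0 : 0 <= c by rewrite divr_ge0// ltW.
pose E m := @theta_term k lam' s h m.
have E0 m : 0 <= E m by exact: expR_ge0.
pose g m := E m * sg m.
have sg0 m : 0 <= sg m.
  have [gs _] := sgP m; apply: has_sum_ge0 gs => x.
  by rewrite mulr_ge0 ?gauss_fun_ge0//; case: ifP.
have g0 m : 0 <= g m by rewrite mulr_ge0.
have v0 m : 0 <= v (odd_count m) * E m by rewrite mulr_ge0//; have /andP[] := vB (odd_count m).
(* The two-sided estimate is split into two inequalities without subtraction, so that both sides
   remain nonnegative families. *)
have g_le m : g m <= c * (v (odd_count m) * E m) + 8 * B * (1 * E m).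
  have [_] := sgP m; rewrite ler_norml -/c => /andP[_ H].
  rewrite (_ : _ + _ = E m * (v (odd_count m) * c + 8 * B)); last by ring.
  by rewrite ler_wpM2l// -lerBlDl.
have g_ge m : c * (v (odd_count m) * E m) <= g m + 8 * B * (1 * E m).
  have [_] := sgP m; rewrite ler_norml -/c => /andP[H _].
  rewrite (_ : _ + _ = E m * (sg m + 8 * B)) ?/g; last by ring.
  by rewrite mulrC -mulrA mulrC -mulrA ler_wpM2l// mulrC; lra.
have B80 : 0 <= 8 * B by rewrite mulr_ge0.
have E10 m : 0 <= 1 * E m by rewrite mul1r.
have cU := has_sumZ c0 Us; have BV := has_sumZ B80 Vs.
have cU0 m : 0 <= c * (v (odd_count m) * E m) by rewrite mulr_ge0.
have BV0 m : 0 <= 8 * B * (1 * E m) by rewrite mulr_ge0.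
have hi := has_sumD cU0 BV0 cU BV.
have [S gS] : exists S, has_sum g S.
  by apply: has_sum_le_ex hi => m; rewrite g0 g_le.
have S_le : S <= c * U + 8 * B * V by exact: has_sum_le hi.
have S_ge : c * U <= S + 8 * B * V.
  by apply: has_sum_le cU (has_sumD g0 BV0 gS BV).
exists S.
  apply: (has_sum_bij (consf_bij k)); apply: has_sum_pair gS => [[m x]|m] /=.
    by rewrite mulr_ge0 ?expR_ge0.
  have [gs _] := sgP m; apply: eq_has_sum (has_sumZ (E0 m) gs) => x /=.
  rewrite theta_term_consf// odd_count_consf -/lam' -/r /E mulrCA; congr (_ * _).
  by case: (odd _).
have Vh : V * h ^+ k <= q ^+ k + C.
  move: Vb; rewrite binomial_mean_cst mul1r mulr1 ler_norml => /andP[_ Vb].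
  have : q ^+ k / Num.sqrt (1 + k%:R * lam') <= q ^+ k.
    rewrite ler_pdivrMr; last first.
      by rewrite sqrtr_gt0 ltr_wpDr// mulr_ge0.
    rewrite ler_peMr ?exprn_ge0// -[leLHS]sqrtr1 ler_sqrt; last first.
      by rewrite addr_ge0// mulr_ge0.
    by rewrite lerDl mulr_ge0.
  have : C * h <= C by rewrite ler_piMr.
  by lra.
have rr : r * Num.sqrt (1 + k%:R * lam') = Num.sqrt (1 + k.+1%:R * lam).
  rewrite -sqrtrM ?(ltW l10)//; congr Num.sqrt.
  by rewrite /lam' -natr1; field; rewrite gt_eqF.
rewrite -rr /= -/v exprSr.
(* The first term is the accumulated inner error, bounded through [V]; the second is the error of
   the induction hypothesis for the averaged weight [v]. *)
rewrite (_ : _ - _ = h * ((S - c * U) * h ^+ k) + q / r * (U * h ^+ k -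
  binomial_mean k v * q ^+ k / Num.sqrt (1 + k%:R * lam'))); last first.
  rewrite /c exprSr; field; rewrite !gt_eqF//=.
  by rewrite sqrtr_gt0 ltr_wpDr// mulr_ge0.
rewrite (le_trans (ler_normD _ _))//.
have hk0 : 0 <= h ^+ k by rewrite exprn_ge0// ltW.
rewrite (_ : (_ + _) * B * h = h * (8 * B * (q ^+ k + C)) + q * (C * B * h)); last by ring.
apply: lerD.
  rewrite normrM (gtr0_norm h0) ler_pM2l// normrM (ger0_norm hk0).
  have : `|S - c * U| <= 8 * B * V by rewrite ler_norml; lra.
  move=> /(fun H => ler_wpM2r hk0 H) /le_trans; apply.
  by rewrite -[leLHS]mulrA ler_wpM2l.
rewrite normrM ger0_norm ?divr_ge0 ?(ltW r0)//.
apply: ler_pM => //; first by rewrite divr_ge0// ltW.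
by rewrite ler_pdivrMr// ler_peMr.
Qed.

End ThetaSum.

(** * Signs and their binomial means *)

Section Signs.
Context {R : realType}.
Implicit Types (n : int) (w v : nat -> R).

(* The value of (-1)^(Q(m) - n S(m)) when m has j odd entries and eps = (-1)^n:
   modulo 2, Q(m) is j(j+1)/2 and S(m) is j. *)
Definition parity_sign (eps : R) (j : nat) : R := (-1) ^+ 'C(j.+1, 2) * eps ^+ j.

Lemma parity_signS (eps : R) j :
  parity_sign eps j.+1 = (-1) ^+ j.+1 * eps * parity_sign eps j.
Proof.
rewrite /parity_sign binS bin1 exprD (exprS eps).
by move: (_ ^+ j.+1) (_ ^+ 'C(_, _)) => x y; ring.
Qed.

Lemma exprN1z_double (z : int) : (-1 : R) ^ (2 * z) = 1.
Proof. by rewrite -exprz_exp -[(-1) ^ 2]/((-1) ^+ 2) sqrrN expr1n exp1rz. Qed.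

Lemma exprN1zN (z : int) : (-1 : R) ^ (- z) = (-1) ^ z.
Proof.
have -> : z = - z + 2 * z by ring.
rewrite expfzDr ?oppr_eq0 ?oner_neq0// exprN1z_double mulr1.
by congr (_ ^ _); ring.
Qed.

Lemma exprN1z_cases (z : int) : {(-1 : R) ^ z = 1} + {(-1 : R) ^ z = -1}.
Proof.
case: (boolP (odd `|z|%N)) => zo.
  right; rewrite (_ : z = 1 + 2 * (z %/ 2)%Z); last by lia.
  by rewrite expfzDr ?oppr_eq0 ?oner_neq0// exprN1z_double mulr1.
left; rewrite (_ : z = 2 * (z %/ 2)%Z); last by lia.
exact: exprN1z_double.
Qed.

Lemma sign_linear_form k (m : {ffun 'I_k -> int}) :
  (-1 : R) ^ linear_form m = (-1) ^+ odd_count m.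
Proof.
have N10 : (-1 : R) != 0 by rewrite oppr_eq0 oner_neq0.
elim: k m => [|k IH] m.
  by rewrite /linear_form /odd_count !big_ord0.
have [e _ eK] := consf_bij k; rewrite -(eK m); case: (e m) => {}m x.
rewrite linear_form_consf odd_count_consf expfzDr// exprD IH; congr (_ * _).
case: (boolP (odd `|x|%N)) => xo.
  rewrite {1}(_ : x = 1 + 2 * (x %/ 2)%Z); last by lia.
  by rewrite expfzDr// exprN1z_double mulr1.
rewrite {1}(_ : x = 2 * (x %/ 2)%Z); last by lia.
by rewrite exprN1z_double.
Qed.

(** A new entry [x] adds [x ^+ 2 + x * S - n * x] to the exponent, where [S] is the sum of the other
    entries. Modulo 2 this is 0 for even [x] and [1 + S - n] for odd [x], which is the recurrence of
    [parity_signS]. *)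
Lemma sign_quadratic_form k n (m : {ffun 'I_k -> int}) :
  (-1 : R) ^ (quadratic_form m - n * linear_form m) =
  parity_sign ((-1) ^ n) (odd_count m).
Proof.
have N10 : (-1 : R) != 0 by rewrite oppr_eq0 oner_neq0.
elim: k m => [|k IH] m.
  rewrite /quadratic_form /linear_form /odd_count !big_ord0 mulr0 subr0.
  by rewrite /parity_sign /= !expr0 mulr1.
have [e _ eK] := consf_bij k; rewrite -(eK m); case: (e m) => {}m x.
rewrite quadratic_form_consf linear_form_consf odd_count_consf.
case: (boolP (odd `|x|%N)) => xo.
  rewrite add1n parity_signS -IH (exprS _ (odd_count m)) -sign_linear_form -(exprN1zN n).
  rewrite (_ : _ - _ = 2 * (let y := (x %/ 2)%Z in
      2 * y ^+ 2 + 2 * y + y * linear_form m - n * y) + 1 + linear_form m - n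
      + (quadratic_form m - n * linear_form m)); last first.
    by rewrite {1 2 3}(_ : x = 2 * (x %/ 2)%Z + 1) /=; [ring|lia].
  by rewrite !expfzDr// exprN1z_double mul1r.
rewrite add0n -IH (_ : _ - _ = 2 * (let y := (x %/ 2)%Z in
    2 * y ^+ 2 + y * linear_form m - n * y)
    + (quadratic_form m - n * linear_form m)); last first.
  by rewrite {1 2 3}(_ : x = 2 * (x %/ 2)%Z) /=; [ring|lia].
by rewrite expfzDr// exprN1z_double mul1r.
Qed.

Lemma binomial_meanD k w v :
  binomial_mean k (fun j => w j + v j) = binomial_mean k w + binomial_mean k v.
Proof.
elim: k w v => //= k IH w v; rewrite -IH; congr binomial_mean.
by apply/funext => j; field.
Qed.

Lemma binomial_meanZ k (c : R) w :
  binomial_mean k (fun j => c * w j) = c * binomial_mean k w.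
Proof.
elim: k w => //= k IH w; rewrite -IH; congr binomial_mean.
by apply/funext => j; field.
Qed.

(** Averaging [cos (X - b)] and [cos (X + b)] gives [cos b * cos X], so each mean costs a factor
    [cos b] and advances the phase by [b]. *)
Lemma binomial_mean_cos k (th b : R) :
  binomial_mean k (fun j => cos (th + j%:R * (2 * b))) =
  cos b ^+ k * cos (th + k%:R * b).
Proof.
elim: k th => [|k IH] th /=; first by rewrite !mul0r expr0 mul1r.
rewrite (_ : (fun j => _) = (fun j => cos b * cos ((th + b) + j%:R * (2 * b)))); last first.
  apply/funext => j; rewrite -(natr1 j).
  rewrite (_ : th + j%:R * (2 * b) = (th + b + j%:R * (2 * b)) - b); last by ring.
  rewrite (_ : th + (j%:R + 1) * (2 * b) = (th + b + j%:R * (2 * b)) + b); last by ring.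
  by move: (th + b + _) => X; rewrite cosB cosD; field.
rewrite binomial_meanZ IH mulrA -exprS -(natr1 k); congr (_ * cos _); ring.
Qed.

Lemma cos_pi4 : cos (pi / 4) = (Num.sqrt 2)^-1 :> R.
Proof. by rewrite -atan1 cos_atan expr1n. Qed.

Lemma sin_pi4 : sin (pi / 4) = (Num.sqrt 2)^-1 :> R.
Proof.
rewrite -cos_pi4 -(cosN (pi / 4)) -cosBpihalf; by congr cos; field.
Qed.

(** Both sides change sign when [j] grows by 2, the cosine because its phase moves by [pi] or
    [- pi]. Hence the induction carries two consecutive values. *)
Lemma parity_sign_cos (eps : R) j : eps = 1 \/ eps = -1 ->
  parity_sign eps j = Num.sqrt 2 * cos (pi / 4 + j%:R * (2 * (eps * (pi / 4)))).
Proof.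
move=> epsE.
have s0 : Num.sqrt 2 != 0 :> R by rewrite gt_eqF// sqrtr_gt0.
have eps2 : eps ^+ 2 = 1 by case: epsE => ->; rewrite ?sqrrN expr1n.
suff : parity_sign eps j = Num.sqrt 2 * cos (pi / 4 + j%:R * (2 * (eps * (pi / 4)))) /\
  parity_sign eps j.+1 = Num.sqrt 2 * cos (pi / 4 + j.+1%:R * (2 * (eps * (pi / 4)))).
  by case.
elim: j => [|j [IH0 IH1]]; split => //.
- by rewrite mul0r addr0 cos_pi4 /parity_sign !expr0 mulr1 divff.
- rewrite /parity_sign !expr1 mul1r; case: epsE => ->.
    rewrite (_ : pi / 4 + _ = pi / 4 + pi / 2); last by field.
    by rewrite cosDpihalf sin_pi4 mulrN divff// mulr1.
  rewrite (_ : pi / 4 + _ = - (pi / 4)); last by field.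
  by rewrite cosN cos_pi4 divff// mulrNN mulr1.
- rewrite 2!parity_signS IH0.
  rewrite (_ : _ * _ * _ = - ((-1) ^+ j) ^+ 2 * eps ^+ 2 * (Num.sqrt 2 *
    cos (pi / 4 + j%:R * (2 * (eps * (pi / 4)))))); last by rewrite !exprS; ring.
  rewrite eps2 -exprM mulnC exprM sqrrN !expr1n mulr1 mulN1r -mulrN.
  congr (_ * _); rewrite -[j.+2]addn2 natrD; case: epsE => ->.
    rewrite (_ : _ + (_ + 2) * _ = pi / 4 + j%:R * (2 * (1 * (pi / 4))) + pi); last by field.
    by rewrite cosDpi.
  rewrite (_ : _ + (_ + 2) * _ = pi / 4 + j%:R * (2 * (-1 * (pi / 4))) - pi); last by field.
  by rewrite -[X in - cos X](subrK pi) cosDpi opprK.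
Qed.

(** The powers of [cos (pi / 4)] cancel [Num.sqrt 2 ^+ k]. The final phase is
    [eps * (k%:R + eps) * pi / 4], since [eps ^+ 2 = 1], and the cosine is even. *)
Lemma binomial_mean_parity_sign k (eps : R) : eps = 1 \/ eps = -1 ->
  binomial_mean k (parity_sign eps) * Num.sqrt 2 ^+ k =
  Num.sqrt 2 * cos ((k%:R + eps) * pi / 4).
Proof.
move=> epsE; have s0 : Num.sqrt 2 != 0 :> R by rewrite gt_eqF// sqrtr_gt0.
rewrite (_ : parity_sign eps = (fun j => Num.sqrt 2 *
  cos (pi / 4 + j%:R * (2 * (eps * (pi / 4)))))); last first.
  by apply/funext => j; exact: parity_sign_cos.
rewrite binomial_meanZ binomial_mean_cos.
have -> : cos (eps * (pi / 4)) = (Num.sqrt 2)^-1.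
  by rewrite -cos_pi4; case: epsE => ->; rewrite ?mul1r// mulN1r cosN.
rewrite -mulrA mulrAC exprVn mulVf ?expf_neq0// mul1r; congr (_ * _).
case: epsE => ->; first by congr cos; field.
by rewrite -cosN; congr cos; field.
Qed.

End Signs.

(** * From nonnegative real sums to unordered complex sums *)

Section ComplexSum.
Context {R : realType}.

Lemma normc_real (x : R) : `|x%:C| = `|x|%:C :> R[i].
Proof. by rewrite normc_def /= expr0n addr0 sqrtr_sqr. Qed.

Lemma complex_sum (T : choiceType) (f g : T -> R) (s t : R) :
  (forall i, 0 <= f i) -> (forall i, 0 <= g i) ->
  has_sum f s -> has_sum g t ->
  summability.sum (fun i => ((f i - g i)%:C : (R[i])^o)) = ((s - t)%:C : (R[i])^o).
Proof.
move=> f0 g0 fs gt.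
have FF : ProperFilter (@summability.totally T) by exact: summability.totally_filter.
apply: cvg_lim; first exact: norm_hausdorff.
apply/cvgrPdist_le => e e0.
(* In the order on [R[i]], a positive element is real. *)
have eE : e = (complex.Re e)%:C.
  by move: e0; case: e => a b; rewrite ltcE /= => /andP[/eqP -> _].
have e0' : 0 < complex.Re e / 2.
  by move: e0; case: e {eE} => a b; rewrite ltcE /= => /andP[_ a0]; rewrite divr_gt0.
have [A HA] := has_sum_fset f0 fs e0'; have [B HB] := has_sum_fset g0 gt e0'.
(* Beyond the union both partial sums are within half of [e] of their limits. *)
exists (A `|` B)%fset => // X /=; rewrite fsubUset => /andP[/HA hA /HB hB].
rewrite /summability.partial_sum.
have -> : \sum_(i : X) ((f (val i) - g (val i))%:C : (R[i])^o) =
    (\sum_(i <- X) f i - \sum_(i <- X) g i)%:C.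
  by rewrite -sumrB (big_seq_fsetE _ _ _ _) /= rmorph_sum.
rewrite -rmorphB normc_real eE lecR.
by move: hA hB => /andP[? ?] /andP[? ?]; rewrite ler_norml; lra.
Qed.

End ComplexSum.

(** * Asymptotics *)

Section Asymptotics.
Context {R : realType}.
Implicit Types (n : int) (x h : R).

(** Here [x = expR (- (2 * h ^+ 2))], and by [quadratic_formE] twice the exponent is the square sum
    plus [(S - n) ^ 2 - n ^ 2], with [S] the linear form. *)
Lemma exprz_theta_term k n x h (m : {ffun 'I_k -> int}) :
  0 < x -> h ^+ 2 = - ln x / 2 ->
  x ^ (quadratic_form m - n * linear_form m) =
  expR (h ^+ 2 * n%:~R ^+ 2) * theta_term 1 (- n%:~R) h m.
Proof.
move=> x0 hx; rewrite -powR_intmul ?(ltW x0)// /powR gt_eqF// /theta_term -expRD.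
congr expR.
have := congr1 (intr : int -> R) (quadratic_formE m).
rewrite intrM intrD rmorphXn /= => q2.
rewrite intrB intrM.
have -> : ln x = - (2 * h ^+ 2) by rewrite hx; field.
have -> : (quadratic_form m)%:~R =
  ((square_sum m)%:~R + (linear_form m)%:~R ^+ 2) / 2 :> R.
  by rewrite -q2; field.
by field.
Qed.

(* [esum] only handles nonnegative terms, so the sign w is written (1 + w) - 1. *)
Lemma fkn_theta_sum k n x h (s t : R) :
  0 < x -> h ^+ 2 = - ln x / 2 ->
  has_sum (fun m : {ffun 'I_k -> int} =>
    (1 + parity_sign ((-1) ^ n) (odd_count m)) * theta_term 1 (- n%:~R) h m) s ->
  has_sum (fun m : {ffun 'I_k -> int} => 1 * theta_term 1 (- n%:~R) h m) t ->
  fkn k n (- x)%:C = ((expR (h ^+ 2 * n%:~R ^+ 2) * (s - t))%:C : (R[i])^o).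
Proof.
move=> x0 hx hs ht; set c := expR _; have c0 : 0 <= c by exact: expR_ge0.
rewrite mulrBr; rewrite -(complex_sum (T := {ffun 'I_k -> int})
  (f := fun m => c * ((1 + parity_sign ((-1) ^ n) (odd_count m)) * theta_term 1 (- n%:~R) h m))
  (g := fun m => c * (1 * theta_term 1 (- n%:~R) h m))).
- rewrite /fkn; congr summability.sum; apply/funext => m.
  rewrite -fmorphXz; congr (_%:C).
  rewrite -(mulN1r x) expfzMl sign_quadratic_form (exprz_theta_term n m x0 hx) -/c.
  ring.
- move=> m; rewrite mulr_ge0// mulr_ge0 ?expR_ge0//.
  rewrite -sign_quadratic_form; 
  by have [->|->] := @exprN1z_cases R (quadratic_form m - n * linear_form m); lra.
- by move=> m; rewrite mulr_ge0// mul1r expR_ge0.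
- exact: has_sumZ hs.
- exact: has_sumZ ht.
Qed.

Lemma bernoulli_ineq (y : R) k : 0 <= y <= 1 -> 1 - k%:R * y <= (1 - y) ^+ k.
Proof.
move=> /andP[y0 y1]; elim: k => [|k IH]; first by rewrite mul0r subr0 expr0.
have H : (1 - y) * (1 - k%:R * y) <= (1 - y) ^+ k.+1.
  by rewrite exprS ler_wpM2l// subr_ge0.
apply: le_trans H; rewrite -(natr1 k).
have : 0 <= k%:R * y * y by rewrite !mulr_ge0.
lra.
Qed.

Lemma expR_sub1_le (u : R) : expR u - 1 <= u * expR u.
Proof.
have e0 := expR_gt0 u; have := expR_ge1Dx (- u).
rewrite expRN -(ler_pM2r e0) mulVf ?gt_eqF//; lra.
Qed.

(** Both bounds are [ln (1 + u) <= u], at [u = x - 1] and at [u = x^-1 - 1]. *)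
Lemma ln_bounds x : 2^-1 < x < 1 -> 1 - x <= - ln x <= (1 - x) / x.
Proof.
move=> /andP[x2 x1]; have x0 : 0 < x by apply: lt_trans x2; rewrite invr_gt0.
have := @le_ln1Dx R (x - 1) ltac:(lra).
have := @le_ln1Dx R (x^-1 - 1).
rewrite (addrC 1 (x^-1 - 1)) (addrC 1 (x - 1)) !subrK lnV// => H1 H2.
have xV : 0 < x^-1 by rewrite invr_gt0.
have {}H1 := H1 ltac:(lra).
apply/andP; split; first lra.
by rewrite mulrBl mul1r divff ?gt_eqF.
Qed.

(** The asymptotics multiplied by [(1 - x) ^ (k / 2)], which makes the main term a constant. The
    value is produced as a real [F], so that the estimate takes place in [R]. *)
Lemma fkn_asymptotic k n : exists2 C : R, 0 <= C & forall x, 2^-1 < x < 1 ->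
  exists2 F : R, fkn k n (- x)%:C = (F%:C : (R[i])^o) &
  `|F * Num.sqrt (1 - x) ^+ k -
    Num.sqrt pi ^+ k * Num.sqrt 2 / Num.sqrt (k%:R + 1) *
      cos ((k%:R + (-1) ^ n) * pi / 4)| <= C * Num.sqrt (1 - x).
Proof.
have [C0 C0p HC] := @theta_sum R k (- n%:~R).
set K := _ * cos _.
set eps : R := (-1) ^ n in K *.
have epsE : eps = 1 \/ eps = -1.
  by rewrite /eps; have [->|->] := @exprN1z_cases R n; [left|right].
set N : R := n%:~R in HC *.
have N20 : 0 <= N ^+ 2 by exact: sqr_ge0.
set c1 := expR (N ^+ 2).
have c1_0 : 0 <= c1 by exact: expR_ge0.
(* The 3 is the sum of the weight bounds 2, for [1 + parity_sign], and 1, for the constant weight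
   subtracted from it. *)
set C1 := Num.sqrt 2 ^+ k * (3 * C0).
have C10 : 0 <= C1 by rewrite !mulr_ge0// exprn_ge0 ?sqrtr_ge0.
exists (c1 * C1 + `|K| * (N ^+ 2 * c1 + k%:R)).
  by apply: addr_ge0; apply: mulr_ge0 => //; apply: addr_ge0 => //; apply: mulr_ge0.
move=> x x12; have /andP[x2 x1] := x12.
have x0 : 0 < x by apply: lt_trans x2; rewrite invr_gt0.
have /andP[t1 t2] := ln_bounds x12.
set t := - ln x in t1 t2.
have y0 : 0 < 1 - x by lra.
have t0 : 0 < t by lra.
(* This uses [x > 1 / 2], and it yields [h <= g], so errors in [h] become errors in [g]. *)
have ty : t <= 2 * (1 - x).
  apply: le_trans t2 _; rewrite ler_pdivrMr//.
  have : 0 <= (1 - x) * (2 * x - 1) by apply: mulr_ge0; lra.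
  lra.
set g := Num.sqrt (1 - x).
have g0 : 0 < g by rewrite sqrtr_gt0.
have gg : g ^+ 2 = 1 - x by rewrite sqr_sqrtr// ltW.
have g1 : g <= 1 by rewrite -(@expr_le1 _ 2)// ?gg ?(ltW g0)//; lra.
set h := Num.sqrt (t / 2).
have h0 : 0 < h by rewrite sqrtr_gt0 divr_gt0.
have hh : h ^+ 2 = t / 2 by rewrite sqr_sqrtr// divr_ge0// ltW.
have hg : h <= g by rewrite ler_wsqrtr// ler_pdivrMr// mulrC.
have h1 : h <= 1 by exact: le_trans g1.
have h01 : 0 < h <= 1 by rewrite h0.
have l01 : 0 <= (1 : R) <= 1 by rewrite ler01 lexx.
have w1 j : 0 <= 1 + parity_sign eps j <= 2.
  have : parity_sign eps j = 1 \/ parity_sign eps j = -1.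
    elim: j => [|j IH]; first by left; rewrite /parity_sign !expr0 mulr1.
    rewrite parity_signS -signr_odd.
    by case: odd; case: IH => ->; case: epsE => ->; rewrite ?expr0 ?expr1;
      [right|left|left|right|left|right|right|left]; ring.
  by case=> ->; lra.
have [S1 hS1 b1] := HC 1 h 2 _ l01 h01 w1.
have [S2 hS2 b2] := HC 1 h 1 (fun=> 1) l01 h01 (fun=> l01).
exists (expR (h ^+ 2 * N ^+ 2) * (S1 - S2)); first exact: fkn_theta_sum hS1 hS2.
set c := expR (h ^+ 2 * N ^+ 2).
have h21 : h ^+ 2 <= 1 by rewrite expr_le1// ltW.
have c_le : c <= c1 by rewrite ler_expR ler_piMl.
have c_ge1 : 1 <= c by rewrite -expR0 ler_expR mulr_ge0 ?sqr_ge0.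
have h2g : h ^+ 2 <= g.
  by rewrite (le_trans _ hg)// expr2 ler_piMl// ltW.
have c_sub : c - 1 <= N ^+ 2 * c1 * g.
  apply: le_trans (expR_sub1_le _) _; rewrite -/c.
  rewrite (_ : N ^+ 2 * c1 * g = g * N ^+ 2 * c1); last by ring.
  by apply: ler_pM; rewrite ?expR_ge0 ?(mulr_ge0 (sqr_ge0 _) N20) ?ler_wpM2r.
(* The square of [rho] is [(1 - x) / (- ln x)], which lies between [x] and 1. Thus [rho] measures
   the cost of replacing [- ln x] by [1 - x]. *)
set rho := g / (Num.sqrt 2 * h).
have s20 : 0 < Num.sqrt 2 :> R by rewrite sqrtr_gt0.
have sh0 : 0 < Num.sqrt 2 * h by rewrite mulr_gt0.
have rho0 : 0 < rho by rewrite divr_gt0.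
have rho2 : rho ^+ 2 = (1 - x) / t.
  rewrite /rho expr_div_n gg exprMn hh sqr_sqrtr//; congr (_ / _); by field.
have rho2_le : rho ^+ 2 <= 1 by rewrite rho2 ler_pdivrMr// mul1r.
have rho1 : rho <= 1 by rewrite -(@expr_le1 _ 2)// ltW.
have rho2_ge : x <= rho ^+ 2.
  by rewrite rho2 ler_pdivlMr// mulrC -ler_pdivlMr.
have rhok1 : rho ^+ k <= 1 by rewrite exprn_ile1// ltW.
(* As [rho <= 1], also [x <= rho]; Bernoulli's inequality for [x ^+ k] concludes, with
   [1 - x = g ^+ 2 <= g]. *)
have rhok : 1 - k%:R * g <= rho ^+ k.
  have : x ^+ k <= rho ^+ k.
    apply: lerXn2r; rewrite ?nnegrE ?(ltW x0) ?(ltW rho0)//.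
    by apply: le_trans rho2_ge _; rewrite expr2 ler_piMl// ltW.
  have := @bernoulli_ineq (1 - x) k ltac:(lra); rewrite opprB addrCA subrr addr0.
  have : k%:R * (1 - x) <= k%:R * g.
    by rewrite ler_wpM2l// -gg expr2 ler_piMl// ltW.
  lra.
have rhok0 : 0 <= rho ^+ k by rewrite exprn_ge0// ltW.
have main : `|(S1 - S2) * (Num.sqrt 2 * h) ^+ k - K| <= C1 * h.
  move: b1 b2; rewrite binomial_meanD binomial_mean_cst mulr1.
  set q := Num.sqrt pi ^+ k; set d := Num.sqrt _; set A := binomial_mean _ _.
  move=> b1 b2.
  have -> : K = Num.sqrt 2 ^+ k * (A * q / d).
    transitivity (A * Num.sqrt 2 ^+ k * (q / d)); last by ring.
    by rewrite binomial_mean_parity_sign// /K /d addrC -/q; ring.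
  rewrite exprMn.
  rewrite (_ : _ - _ = Num.sqrt 2 ^+ k * ((S1 * h ^+ k - (1 + A) * q / d) -
    (S2 * h ^+ k - 1 * q / d))); last by ring.
  have s2k : 0 <= Num.sqrt 2 ^+ k :> R by rewrite exprn_ge0 ?sqrtr_ge0.
  rewrite normrM (ger0_norm s2k).
  rewrite (_ : C1 * h = Num.sqrt 2 ^+ k * (C0 * 2 * h + C0 * 1 * h)); last first.
    by rewrite /C1; ring.
  rewrite ler_wpM2l// (le_trans (ler_normB _ _))//.
  exact: lerD.
(* The theta sum error is separated from the error of replacing the prefactor [c * rho ^+ k] by 1;
   each is linear in [g]. *)
have -> : c * (S1 - S2) * g ^+ k - K =
  c * rho ^+ k * ((S1 - S2) * (Num.sqrt 2 * h) ^+ k - K) + K * (c * rho ^+ k - 1).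
  have -> : g = rho * (Num.sqrt 2 * h) by rewrite divfK// gt_eqF.
  by rewrite [(rho * _) ^+ k]exprMn; ring.
rewrite (le_trans (ler_normD _ _))// [leRHS]mulrDl; apply: lerD; rewrite normrM.
  rewrite (ger0_norm (mulr_ge0 (expR_ge0 _) rhok0)) -[leRHS]mulrA.
  apply: ler_pM => //; first exact: mulr_ge0 (expR_ge0 _) rhok0.
    by apply: le_trans c_le; rewrite ler_piMr ?expR_ge0.
  by apply: le_trans main _; rewrite ler_wpM2l.
rewrite -[leRHS]mulrA ler_wpM2l// mulrDl ler_norml.
have : (c - 1) * rho ^+ k <= c - 1 by rewrite ler_piMr// subr_ge0.
have : 0 <= (c - 1) * rho ^+ k by rewrite mulr_ge0// subr_ge0.
have : 0 <= N ^+ 2 * c1 * g by rewrite mulr_ge0 ?(mulr_ge0 N20 c1_0) ?ltW.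
have : 0 <= k%:R * g by rewrite mulr_ge0// ltW.
by move=> *; apply/andP; split; lra.
Qed.

End Asymptotics.

(** * The estimate with real powers and Landau notation *)

Lemma powR_half (R : realType) (a : R) (k : nat) : 0 <= a ->
  a `^ (k%:R / 2) = Num.sqrt a ^+ k.
Proof.
by move=> a0; rewrite mulrC powRrM powR12_sqrt// powR_mulrn.
Qed.

Unset Implicit Arguments.
Set Strict Implicit.

Theorem theorem1 (R : realType) (k : nat) (n : int) (hk : (1 <= k)%N) :
  let eps : R := (-1) ^ n in
  (fun x : R => fkn k n (- x)%:C) =
  (fun x : R =>
     ((pi `^ (k%:R / 2) * Num.sqrt 2 / Num.sqrt (k%:R + 1)
       * (cos ((k%:R + eps) * pi / 4) / (1 - x) `^ (k%:R / 2)))%:C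
      : (R[i])^o))
  +O_ (1^'-) (fun x : R => ((1 / (1 - x) `^ ((k%:R - 1) / 2))%:C : (R[i])^o)).
Proof.
move=> eps; apply/eqaddOP/bigO_exP.
have [C C0 HC] := @fkn_asymptotic R k n.
(* The Landau constant must be positive, while [C] is only nonnegative. *)
exists (C + 1)%:C; first by rewrite ltcR ltr_wpDl.
near=> x.
have x12 : 2^-1 < x < 1.
  apply/andP; split; last by near: x; exact: nbhs_left_lt.
  by near: x; apply: nbhs_left_gt; rewrite invf_lt1// ltr1n.
have y0 : 0 < 1 - x by rewrite subr_gt0; case/andP: x12.
have [F FE Fb] := HC x x12.
rewrite /= fctE FE -rmorphB !normc_real -rmorphM lecR.
(* As [k >= 1], the exponent [(k - 1) / 2] is half of a natural number, and all powers become
   natural powers of [g]. *)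
case: k hk HC FE Fb => // k _ _ _ Fb.
rewrite -[X in (X - 1) / 2]natr1 addrK !powR_half ?pi_ge0 ?(ltW y0)//.
set g := Num.sqrt (1 - x) in Fb *.
have g0 : 0 < g by rewrite sqrtr_gt0.
have gk0 : 0 < g ^+ k.+1 by rewrite exprn_gt0.
rewrite -(ler_pM2r gk0) -[X in _ * X <= _](gtr0_norm gk0) -normrM mulrBl.
rewrite (ger0_norm (_ : 0 <= 1 / g ^+ k)); last by rewrite divr_ge0// exprn_ge0// ltW.
rewrite (_ : (C + 1) * (1 / g ^+ k) * g ^+ k.+1 = (C + 1) * g); last first.
  by rewrite exprS; field; rewrite expf_neq0// gt_eqF.
apply: le_trans (_ : C * g <= _); last by rewrite ler_wpM2r ?(ltW g0)// lerDl.
apply: le_trans Fb.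
rewrite le_eqVlt; apply/orP; left; apply/eqP; congr (`| _ - _|).
by rewrite mulrA divfK ?gt_eqF// -!mulrA.
Unshelve. all: by end_near.
Qed.
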